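(* Let $A\in\mathbb{R}^{m\times n}$ with $m\ge 2$ have pairwise linearly independent rows $a_1^\top,\dots,a_m^\top$, let $b\in\mathbb{R}^m$ be such that $Ax=b$ is consistent, and let $x^\star$ satisfy $Ax^\star=b$. Let $\{x^{(k)}\}$ be generated by the GMIRK method with selected indices $i_0,i_1,\dots$. For every $k\ge1$ for which $x^{(k+1)}$ is generated, put $H_i=\{x\in\mathbb{R}^n : \langle a_i,x\rangle=b_i\}$ and $\Pi_k=x^{(k)}+\operatorname{span}\{a_{i_k},a_{i_{k-1}}\}$. Then: (i) $\{x^{(k+1)}\}=(H_{i_k}\cap H_{i_{k-1}})\cap \Pi_k$; (ii) $x^{(k+1)}$ is the orthogonal projection of $x^\star$ onto $\Pi_k$, i.e. $x^{(k+1)}=\arg\min \|x-x^\star\|_2^2$ subject to $x=x^{(k)}+\tau_1a_{i_k}+\tau_2a_{i_{k-1}}$, $\tau_1,\tau_2\in\mathbb{R}$; (iii) $x^{(k+1)}$ is the orthogonal projection of $x^{(k)}$ onto $H_{i_k}\cap H_{i_{k-1}}$, i.e. $x^{(k+1)}=\arg\min\|x-x^{(k)}\|_2^2$ subject to $\langle a_{i_{k-1}},x\rangle=b_{i_{k-1}}$, $\langle a_{i_k},x\rangle=b_{i_k}$. Equivalently, $x^{(k+1)}=\arg\min\|x-x^{(k)}\|_2^2$ subject to $S^\top Ax=S^\top b$, where $S=[e_{i_k},e_{i_{k-1}}]\in\mathbb{R}^{m\times2}$ and $e_i$ is the $i$-th standard unit vector of $\mathbb{R}^m$.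
   Context: Notation: $[m]=\{1,\dots,m\}$; $a_i\in\mathbb{R}^n$ is the transpose of the $i$-th row of $A$ and $b_i$ the $i$-th entry of $b$; $\|A\|_F$ is the Frobenius norm. For $i\ne j$ the vectors $a_i,a_j$ are assumed linearly independent. Define (empty sums being $0$) $$\gamma_1=\max_{i\in[m]}\sum_{j\ne i}\|a_j\|_2^2,\qquad \gamma_2=\max_{i,j\in[m],\,i\ne j}\ \sum_{k\ne i,j}\|a_k\|_2^2 .$$ GMIRK method (greedy multi-step inertial randomized Kaczmarz). Put $\Gamma_0=\|A\|_F^2$, $\Gamma_1=\gamma_1$, and $\Gamma_k=\gamma_2$ for $k\ge2$. Starting from an arbitrary $x^{(0)}\in\mathbb{R}^n$, for $k=0,1,2,\dots$: if $Ax^{(k)}=b$, terminate (no further iterates or indices are generated). Otherwise: (1) compute $\varepsilon_k=\frac12\left(\frac{1}{\|Ax^{(k)}-b\|_2^2}\max_{i\in[m]}\frac{|a_i^\top x^{(k)}-b_i|^2}{\|a_i\|_2^2}+\frac{1}{\Gamma_k}\right)$; (2) set $\mathcal{I}_k=\{i\in[m] : |a_i^\top x^{(k)}-b_i|^2\ge \varepsilon_k\|Ax^{(k)}-b\|_2^2\|a_i\|_2^2\}$; (3) select an index $i_k\in\mathcal{I}_k$ with $\mathrm{Prob}(i_k=i)=p_i^{(k)}$, where $p_i^{(k)}=0$ for $i\notin\mathcal{I}_k$, $p_i^{(k)}\ge0$ for $i\in\mathcal{I}_k$ and $\sum_{i\in\mathcal{I}_k}p_i^{(k)}=1$ (the probabilities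 are otherwise arbitrary; the selected index always lies in $\mathcal{I}_k$); (4) if $k=0$ set $w^{(0)}=x^{(0)}$; if $k\ge1$ set $$\beta_k=\frac{\langle a_{i_k},a_{i_{k-1}}\rangle\,(\langle a_{i_k},x^{(k)}\rangle-b_{i_k})}{\|a_{i_k}\|_2^2\|a_{i_{k-1}}\|_2^2-\langle a_{i_k},a_{i_{k-1}}\rangle^2},\qquad w^{(k)}=x^{(k)}+\beta_k a_{i_{k-1}};$$ (5) set $x^{(k+1)}=w^{(k)}-\frac{\langle a_{i_k},w^{(k)}\rangle-b_{i_k}}{\|a_{i_k}\|_2^2}a_{i_k}$. *)

(* Defs.v *)
From mathcomp Require Import all_boot all_order all_algebra.
From mathcomp Require Import all_classical all_reals.

Set Implicit Arguments.
Unset Strict Implicit.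
Unset Printing Implicit Defensive.

Import Order.TTheory GRing.Theory Num.Theory.

Local Open Scope classical_set_scope.
Local Open Scope ring_scope.

Section Euclidean.
Variable R : realType.

Definition dot n (u v : 'cV[R]_n) : R := \sum_(i < n) u i 0 * v i 0.

(* The canonical norm `|u| on matrices is the max norm, not this one. *)
Definition norm2 n (u : 'cV[R]_n) : R := Num.sqrt (\sum_(i < n) u i 0 ^+ 2).

Definition normF m n (A : 'M[R]_(m, n)) : R :=
  Num.sqrt (\sum_(i < m) \sum_(j < n) A i j ^+ 2).

(* The set of all minimizers of f over C: "p = argmin f over C" reads
   [argmin f C = [set p]]. *)
Definition argmin T (f : T -> R) (C : set T) : set T :=
  [set p | C p /\ forall y, C y -> f p <= f y].

(* p is the orthogonal projection of z onto the affine subspace C *)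
Definition is_orth_proj n (C : set 'cV[R]_n) (z p : 'cV[R]_n) : Prop :=
  C p /\ forall y, C y -> dot (z - p) (y - p) = 0.

End Euclidean.

Section GMIRK.
Variables (R : realType) (m n : nat) (A : 'M[R]_(m, n)) (b : 'cV[R]_m).

Definition vrow (i : 'I_m) : 'cV[R]_n := (row i A)^T.

Definition pairwise_independent_rows : Prop :=
  forall i j : 'I_m, i != j -> free [:: vrow i; vrow j].

Definition hyperplane (i : 'I_m) : set 'cV[R]_n :=
  [set x | dot (vrow i) x = b i 0].

Definition affine_plane (x u v : 'cV[R]_n) : set 'cV[R]_n :=
  [set x + w | w in [set` <<[:: u; v]>>%VS]].

(* The maxima below are of nonnegative quantities over index sets that are
   nonempty as soon as m >= 2, so the default value 0 is harmless. *)
Definition gamma1 : R :=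
  \big[Num.max/0]_(i < m) \sum_(j < m | j != i) norm2 (vrow j) ^+ 2.

Definition gamma2 : R :=
  \big[Num.max/0]_(ij : 'I_m * 'I_m | ij.1 != ij.2)
    \sum_(k < m | (k != ij.1) && (k != ij.2)) norm2 (vrow k) ^+ 2.

Definition Gamma (k : nat) : R :=
  match k with 0%N => normF A ^+ 2 | 1%N => gamma1 | _ => gamma2 end.

(* When m = 2, Gamma k = 0 for k >= 2, but the method has terminated by then. *)
Definition epsilon (k : nat) (x : 'cV[R]_n) : R :=
  2^-1 * ((norm2 (A *m x - b) ^+ 2)^-1
          * \big[Num.max/0]_(i < m)
              (`|dot (vrow i) x - b i 0| ^+ 2 / norm2 (vrow i) ^+ 2)
          + (Gamma k)^-1).

Definition greedy_set (k : nat) (x : 'cV[R]_n) : {set 'I_m} :=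
  [set i | epsilon k x * norm2 (A *m x - b) ^+ 2 * norm2 (vrow i) ^+ 2
           <= `|dot (vrow i) x - b i 0| ^+ 2]%SET.

(* i is the current index, j the previous one *)
Definition beta (i j : 'I_m) (x : 'cV[R]_n) : R :=
  dot (vrow i) (vrow j) * (dot (vrow i) x - b i 0)
  / (norm2 (vrow i) ^+ 2 * norm2 (vrow j) ^+ 2 - dot (vrow i) (vrow j) ^+ 2).

Definition inertial (x : nat -> 'cV[R]_n) (idx : nat -> 'I_m) (k : nat)
    : 'cV[R]_n :=
  match k with
  | 0%N => x 0%N
  | k'.+1 => x k + beta (idx k) (idx k') (x k) *: vrow (idx k')
  end.

(* The iterate x k is generated iff the method did not stop before step k. *)
Definition generated (x : nat -> 'cV[R]_n) (k : nat) : Prop :=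
  forall j, (j < k)%N -> A *m x j <> b.

(* p is the probability vector from which the index i is drawn *)
Definition selection (k : nat) (x : 'cV[R]_n) (p : 'I_m -> R) (i : 'I_m)
    : Prop :=
  [/\ forall j, j \notin greedy_set k x -> p j = 0,
      forall j, j \in greedy_set k x -> 0 <= p j,
      \sum_(j in greedy_set k x) p j = 1
    & i \in greedy_set k x].

(* (x, idx) is a realization of the method with selection probabilities p.
   The sequences are total functions; their values after termination are
   unconstrained and carry no meaning. *)
Definition GMIRK_run (p : nat -> 'I_m -> R) (x : nat -> 'cV[R]_n)
    (idx : nat -> 'I_m) : Prop :=
  forall k, generated x k.+1 ->
    selection k (x k) (p k) (idx k) /\
    let w := inertial x idx k in
    let i := idx k in
    x k.+1 = w - ((dot (vrow i) w - b i 0) / norm2 (vrow i) ^+ 2) *: vrow i.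

End GMIRK.

(* The m x 2 matrix [e_i, e_j] *)
Definition sketch (R : realType) m (i j : 'I_m) : 'M[R]_(m, 1 + 1) :=
  row_mx (delta_mx i 0) (delta_mx j 0).

(* Main.v *)
Require Import Defs.
From mathcomp Require Import all_boot all_order all_algebra.
From mathcomp Require Import all_classical all_reals.
From mathcomp Require Import ring lra.

Set Implicit Arguments.
Unset Strict Implicit.
Unset Printing Implicit Defensive.

Import Order.TTheory GRing.Theory Num.Theory.

Local Open Scope classical_set_scope.
Local Open Scope ring_scope.

(** Let [i], [j] be the indices drawn at steps [k], [k.-1] and [a_i], [a_j] their
    rows.  The previous
    step projected onto the hyperplane of [a_j], so [x k] has zero residual
    there ([kaczmarz_step_solves]).  The greedy threshold is positive as long
    as [x k] is not a solution, so the row drawn now has a nonzero residual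
    ([greedy_residual_neq0]).  Hence [i] and [j] differ, [a_i] and [a_j] are
    independent, and their Gram determinant, the denominator of [beta], does
    not vanish ([gram_det_neq0]).  With this denominator the inertial step
    followed by the Kaczmarz projection gives a point of the plane
    [x k + span (a_i, a_j)] that satisfies both equations
    ([inertial_step_spec]).

    The rest is geometry.  Any point [q] of that plane lying on both
    hyperplanes is the foot of two perpendiculars at once, because the
    directions of the plane are the normals of the hyperplanes: the projection
    of any solution onto the plane ([plane_proj]) and the projection of [x k]
    onto the intersection of the hyperplanes ([hyperplanes_proj]).  By
    Pythagoras an orthogonal projection is the unique nearest point
    ([argmin_orth_proj]); this gives the minimization statements, and also the
    uniqueness of [q]. *)

(** * The Euclidean inner product *)

Section Euclidean.
Variables (R : realType) (n : nat).
Implicit Types (u v w z : 'cV[R]_n) (C : set 'cV[R]_n).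

Lemma dotE u v : dot u v = (u^T *m v) 0 0.
Proof. by rewrite /dot mxE; apply: eq_bigr => i _; rewrite mxE. Qed.

Lemma dotC u v : dot u v = dot v u.
Proof. by apply: eq_bigr => i _; rewrite mulrC. Qed.

Lemma dotDr u v w : dot u (v + w) = dot u v + dot u w.
Proof. by rewrite !dotE mulmxDr mxE. Qed.

Lemma dotZr a u v : dot u (a *: v) = a * dot u v.
Proof. by rewrite !dotE -scalemxAr mxE. Qed.

Lemma dotNr u v : dot u (- v) = - dot u v.
Proof. by rewrite !dotE mulmxN mxE. Qed.

Lemma dotDl u v w : dot (v + w) u = dot v u + dot w u.
Proof. by rewrite ![dot _ u]dotC dotDr. Qed.

Lemma dotZl a u v : dot (a *: v) u = a * dot v u.
Proof. by rewrite ![dot _ u]dotC dotZr. Qed.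

Lemma dotNl u v : dot (- v) u = - dot v u.
Proof. by rewrite ![dot _ u]dotC dotNr. Qed.

Definition dot_lin := (dotDl, dotDr, dotZl, dotZr, dotNl, dotNr).

Lemma dot_ge0 u : 0 <= dot u u.
Proof. by apply: sumr_ge0 => i _; rewrite -expr2 sqr_ge0. Qed.

Lemma norm2_sqr u : norm2 u ^+ 2 = dot u u.
Proof.
rewrite sqr_sqrtr; last by apply: sumr_ge0 => i _; apply: sqr_ge0.
by apply: eq_bigr => i _; rewrite expr2.
Qed.

Lemma dot_eq0 u : (dot u u == 0) = (u == 0).
Proof.
apply/eqP/eqP => [u0|->]; last by rewrite /dot big1 // => i _; rewrite mxE mul0r.
apply/colP => i; rewrite mxE.
have /psumr_eq0P/(_ u0 i isT) : forall k, true -> 0 <= u k 0 * u k 0.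
  by move=> k _; rewrite -expr2 sqr_ge0.
by move/eqP; rewrite mulf_eq0 orbb => /eqP.
Qed.

Lemma dot_gt0 u : (0 < dot u u) = (u != 0).
Proof. by rewrite lt_def dot_eq0 dot_ge0 andbT. Qed.

(** Strict Cauchy-Schwarz: if the Gram determinant vanishes, then so does the
    norm of [dot v v *: u - dot u v *: v], which exhibits [u] as a multiple
    of [v]. *)
Lemma gram_det_neq0 u v :
  free [:: u; v] -> dot u u * dot v v - dot u v ^+ 2 != 0.
Proof.
rewrite free_cons seq1_free span_seq1 => /andP[uNv v0]; apply: contra uNv => D0.
have : dot (dot v v *: u - dot u v *: v) (dot v v *: u - dot u v *: v) =
         dot v v * (dot u u * dot v v - dot u v ^+ 2).
  by rewrite !dot_lin (dotC v u); ring.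
move/eqP; rewrite (eqP D0) mulr0 dot_eq0 subr_eq0 => /eqP uv.
apply/vlineP; exists ((dot v v)^-1 * dot u v).
by rewrite -scalerA -uv scalerA mulVf ?scale1r // dot_eq0.
Qed.

(** Pythagoras: [|y - z|^2 = |q - z|^2 + |y - q|^2] for [y] in [C]. *)
Lemma argmin_orth_proj C z q :
  is_orth_proj C z q -> argmin (fun y => norm2 (y - z) ^+ 2) C = [set q].
Proof.
move=> [Cq orth].
have pyth y : C y ->
    norm2 (y - z) ^+ 2 = norm2 (q - z) ^+ 2 + dot (y - q) (y - q).
  move=> /orth; rewrite !norm2_sqr !dot_lin (dotC z q) (dotC y q) (dotC z y).
  move=> h; lra.
apply/seteqP; split => y /=.
- case=> Cy /(_ q Cq); rewrite (pyth y Cy) gerDl => le0.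
  have : dot (y - q) (y - q) == 0 by rewrite eq_le le0 dot_ge0.
  by rewrite dot_eq0 subr_eq0 => /eqP.
- by move=> ->; split=> // w Cw; rewrite (pyth w Cw) lerDl dot_ge0.
Qed.

Lemma affine_planeE z u v :
  affine_plane z u v =
  [set y | exists t1 t2 : R, y = z + t1 *: u + t2 *: v].
Proof.
apply/seteqP; split => y /=.
- case=> w /=; rewrite span_cons span_seq1.
  move=> /memv_addP[_ /vlineP[s ->] [_ /vlineP[t ->] ->]] <-.
  by exists s, t; rewrite addrA.
- case=> s [t ->]; exists (s *: u + t *: v); rewrite ?addrA //=.
  by rewrite span_cons span_seq1 memv_add ?memvZ ?memv_line.
Qed.

End Euclidean.

(** * One step of the method *)

Section Step.
Variables (R : realType) (m n : nat) (A : 'M[R]_(m, n)) (b : 'cV[R]_m).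
Implicit Types (i j : 'I_m) (x z q : 'cV[R]_n).

Lemma dot_vrow i x : dot (vrow A i) x = (A *m x) i 0.
Proof. by rewrite mxE; apply: eq_bigr => k _; rewrite !mxE. Qed.

Lemma hyperplane_sol z i : A *m z = b -> hyperplane A b i z.
Proof. by move=> Az; rewrite /hyperplane /= dot_vrow Az. Qed.

Lemma sketchE i j :
  [set y | (sketch R i j)^T *m A *m y = (sketch R i j)^T *m b] =
  hyperplane A b i `&` hyperplane A b j.
Proof.
have rowP1 l y : (row l (A *m y) = row l b) <-> hyperplane A b l y.
  rewrite /hyperplane /= dot_vrow; split; first by move/rowP/(_ 0); rewrite !mxE.
  by move=> h; apply/rowP => c; rewrite ord1 mxE [RHS]mxE.
have E y : (sketch R i j)^T *m y = col_mx (row i y) (row j y).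
  by rewrite /sketch tr_row_mx !trmx_delta mul_col_mx -!rowE.
apply/seteqP; split => y /=; rewrite -mulmxA (E _ (A *m y)) (E _ b).
- by move=> /eq_col_mx[/rowP1 ? /rowP1 ?].
- by case=> /rowP1 -> /rowP1 ->.
Qed.

Lemma vrow_neq0 i :
  (2 <= m)%N -> pairwise_independent_rows A -> vrow A i != 0.
Proof.
move=> m2 ind.
have /card_gt0P[j ji] : (0 < #|predC1 i|)%N.
  by rewrite cardC1 card_ord; case: m m2 => [|[]].
have /ind : j != i by [].
by rewrite free_cons seq1_free => /andP[].
Qed.

Lemma kaczmarz_step_solves i w : vrow A i != 0 ->
  hyperplane A b i
    (w - ((dot (vrow A i) w - b i 0) / norm2 (vrow A i) ^+ 2) *: vrow A i).
Proof.
move=> ai0; rewrite /hyperplane /= !dot_lin norm2_sqr divfK ?dot_eq0 //.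
by rewrite opprB addrC subrK.
Qed.

Lemma Gamma_ge0 k : 0 <= Gamma A k.
Proof.
by case: k => [|[|k]] /=; [exact: sqr_ge0 | exact: bigmax_ge_id..].
Qed.

(** A nonzero residual entry makes the maximum in [epsilon], hence the greedy
    threshold, positive; the term [(Gamma A k)^-1] only has to be nonnegative,
    which it is even when [Gamma A k = 0]. *)
Lemma greedy_residual_neq0 k x i :
  (forall l, vrow A l != 0) -> A *m x <> b -> i \in greedy_set A b k x ->
  dot (vrow A i) x != b i 0.
Proof.
move=> a0 /eqP Axb; rewrite inE => thr.
have res_gt0 : 0 < norm2 (A *m x - b) ^+ 2 by rewrite norm2_sqr dot_gt0 subr_eq0.
have [l lP] : exists l, dot (vrow A l) x != b l 0.
  apply/existsP; apply: contraR Axb => /existsPn h; apply/eqP/colP => l.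
  by rewrite -dot_vrow; apply/eqP; move: (h l); rewrite negbK.
have eps_gt0 : 0 < epsilon A b k x.
  rewrite /epsilon mulr_gt0 ?invr_gt0 // ltr_pwDl ?invr_ge0 ?Gamma_ge0 //.
  rewrite mulr_gt0 ?invr_gt0 //.
  apply: (@lt_le_trans _ _
    (`|dot (vrow A l) x - b l 0| ^+ 2 / norm2 (vrow A l) ^+ 2)).
    by rewrite norm2_sqr divr_gt0 ?dot_gt0 // exprn_gt0 // normr_gt0 subr_eq0.
  exact: (le_bigmax _ (fun l => `|dot (vrow A l) x - b l 0| ^+ 2 / _)).
have : 0 < `|dot (vrow A i) x - b i 0| ^+ 2.
  by apply: lt_le_trans thr; rewrite (norm2_sqr (vrow A i)) 2?mulr_gt0 ?dot_gt0.
by apply: contraTneq => ->; rewrite subrr normr0 expr0n ltxx.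
Qed.

(** The value of [beta] is the one for which the second correction, along
    [vrow A i], restores the equation of row [j]. *)
Lemma inertial_step_spec i j x :
  free [:: vrow A i; vrow A j] -> hyperplane A b j x ->
  let w := x + beta A b i j x *: vrow A j in
  let q := w - ((dot (vrow A i) w - b i 0) / norm2 (vrow A i) ^+ 2)
             *: vrow A i in
  (hyperplane A b i `&` hyperplane A b j) q /\
  affine_plane x (vrow A i) (vrow A j) q.
Proof.
move=> indep xj w q.
have ai0 : vrow A i != 0.
  by apply: (free_not0 indep); rewrite mem_head.
split; last first.
  rewrite affine_planeE /q /w; eexists; eexists.
  by rewrite -scaleNr addrAC.
split; first exact: kaczmarz_step_solves.
move: xj (gram_det_neq0 indep) ai0; rewrite -dot_eq0.
rewrite /hyperplane /q /w /beta /= !dot_lin !norm2_sqr (dotC (vrow A j) (vrow A i)).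
move=> -> D0 ai0; field; rewrite ai0 /=; exact: D0.
Qed.

(** * Two perpendiculars with a common foot *)

Section Foot.
Variables (i j : 'I_m) (x q : 'cV[R]_n).
Hypothesis q_sol : (hyperplane A b i `&` hyperplane A b j) q.
Hypothesis q_plane : affine_plane x (vrow A i) (vrow A j) q.

Lemma plane_proj z : (hyperplane A b i `&` hyperplane A b j) z ->
  is_orth_proj (affine_plane x (vrow A i) (vrow A j)) z q.
Proof.
move=> [zi zj]; split=> // y; case: q_sol => qi qj; move: q_plane.
rewrite affine_planeE => -[s [t qE]] [s' [t' ->]].
have -> : x + s' *: vrow A i + t' *: vrow A j - q =
          (s' - s) *: vrow A i + (t' - t) *: vrow A j.
  by rewrite qE !scalerBl; apply/colP => l; rewrite !mxE; ring.
rewrite dotC !dot_lin; move: zi zj qi qj; rewrite /hyperplane /=.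
by move=> -> -> -> ->; ring.
Qed.

Lemma hyperplanes_proj :
  is_orth_proj (hyperplane A b i `&` hyperplane A b j) x q.
Proof.
split=> // y [yi yj]; case: q_sol => qi qj; move: q_plane.
rewrite affine_planeE => -[s [t qE]].
have -> : x - q = (- s) *: vrow A i + (- t) *: vrow A j.
  by rewrite qE; apply/colP => l; rewrite !mxE; ring.
rewrite !dot_lin; move: yi yj qi qj; rewrite /hyperplane /=.
by move=> -> -> -> ->; ring.
Qed.

End Foot.

End Step.

Theorem mainTheorem2 (R : realType) (m n : nat) (A : 'M[R]_(m, n))
    (b : 'cV[R]_m) (xstar : 'cV[R]_n) (p : nat -> 'I_m -> R)
    (x : nat -> 'cV[R]_n) (idx : nat -> 'I_m) (k : nat) :
  (2 <= m)%N ->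
  pairwise_independent_rows A ->
  A *m xstar = b ->
  GMIRK_run A b p x idx ->
  (1 <= k)%N ->
  generated A b x k.+1 ->
  let i := idx k in
  let j := idx k.-1 in
  let H := hyperplane A b in
  let Pi := affine_plane (x k) (vrow A i) (vrow A j) in
  let S := sketch R i j in
  [/\ [set x k.+1] = (H i `&` H j) `&` Pi,
      is_orth_proj Pi xstar (x k.+1) /\
      argmin (fun y => norm2 (y - xstar) ^+ 2)
        [set y | exists t1 t2 : R,
                   y = x k + t1 *: vrow A i + t2 *: vrow A j]
      = [set x k.+1]
    & [/\ is_orth_proj (H i `&` H j) (x k) (x k.+1),
          argmin (fun y => norm2 (y - x k) ^+ 2)
            [set y | dot (vrow A j) y = b j 0 /\ dot (vrow A i) y = b i 0]
          = [set x k.+1]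
        & argmin (fun y => norm2 (y - x k) ^+ 2)
            [set y | S^T *m A *m y = S^T *m b]
          = [set x k.+1]]].
Proof.
move=> m2 indep Axs run k1 gen i j H Pi S.
have a0 l : vrow A l != 0 by exact: vrow_neq0.
have xj : H j (x k).
  case: k k1 gen @i @j @Pi @S => // k _ gen i j _ _.
  have /run[_ ->] : generated A b x k.+1.
    by move=> l lk; apply: gen; rewrite ltnS ltnW.
  exact: kaczmarz_step_solves.
have [[_ _ _ sel] xE] := run k gen.
have ij : i != j.
  apply: contraNneq (greedy_residual_neq0 a0 (gen k (ltnSn k)) sel) => ij.
  by rewrite -/i ij; apply/eqP.
have wE : inertial A b x idx k = x k + beta A b i j (x k) *: vrow A j.
  by rewrite /i /j; case: (k) k1.
have [q_sol q_plane] : (H i `&` H j) (x k.+1) /\ Pi (x k.+1).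
  rewrite xE wE; exact: (inertial_step_spec (indep _ _ ij) xj).
have xs_sol : (H i `&` H j) xstar by split; apply: hyperplane_sol.
have planeP := plane_proj q_sol q_plane xs_sol.
have solP := hyperplanes_proj q_sol q_plane.
split.
- apply/seteqP; split => [y ->|y [y_sol y_plane]] //=.
  (* [y] is a projection of [xstar] as well, and nearest points are unique *)
  have : [set y] y by [].
  rewrite -(argmin_orth_proj (plane_proj y_sol y_plane xs_sol)).
  by rewrite (argmin_orth_proj planeP).
- by split=> //; rewrite -affine_planeE; apply: argmin_orth_proj.
- split=> //; last by rewrite sketchE; apply: argmin_orth_proj.
  by rewrite -(argmin_orth_proj solP) setIC.
Qed.
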